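(* Let $\mathcal{M}=\langle M,\circ,e\rangle$ be an effective mge monoid. Then it is decidable, given a real-time monoidal finite-state transducer $\mathcal{T}=\langle\Sigma^*\times\mathcal{M},Q,I,F,\Delta\rangle$, whether $\mathcal{T}$ is functional.
   Context: A tuple $\langle m_1,\dots,m_n\rangle$ is equalizable if some $\langle x_1,\dots,x_n\rangle$ satisfies $m_1x_1=\dots=m_nx_n$; such a tuple is an equalizer, and it is a most general equalizer (mge) if every equalizer has the form $\langle x_1x,\dots,x_nx\rangle$, $x\in M$. An mge monoid has right cancellation ($ac=bc\Rightarrow a=b$) and an mge for every equalizable pair. It is effective if elements are represented as a recursive subset of $\mathbb{N}$ with computable operation, equality is decidable, equalizability of pairs is decidable, a computable $\eta:M^2\to M^2$ returns an mge for each equalizable pair, and inverses of invertible elements (those $m$ with $mn=e$ for some $n$) are computable. A real-time transducer has finite $\Delta\subseteq Q\times(\Sigma\times M)\times Q$; its language $L(\mathcal{T})$ is the set of labels $\langle u,m\rangle\in\Sigma^*\times M$ of paths (including empty paths, labelled $\langle\varepsilon,e\rangle$) from a state in $I$ to a state in $F$; $\mathcal{T}$ is functional if $L(\mathcal{T})$ is the graph of a partial function. *)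

(* Defs.v *)
(* Computability is modelled explicitly by Kleene-style
   partial recursive programs on nat (with Cantor pairing), since with the
   whitelisted classical axioms a bare Rocq function "T -> bool" would make
   any decidability claim trivial. *)
From Stdlib Require Import Arith List.
Import ListNotations.

Definition cpair (x y : nat) : nat := (x + y) * S (x + y) / 2 + y.

Inductive prog : Type :=
| PZero
| PSucc
| PFst
| PSnd
| PPair (f g : prog)
| PComp (f g : prog)
| PRec  (f g : prog)
| PMu   (f : prog).

Inductive eval : prog -> nat -> nat -> Prop :=
| eZero n : eval PZero n 0
| eSucc n : eval PSucc n (S n)
| eFst x y : eval PFst (cpair x y) x
| eSnd x y : eval PSnd (cpair x y) y
| ePair f g n a b :
    eval f n a -> eval g n b -> eval (PPair f g) n (cpair a b)
| eComp f g n a b :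
    eval g n a -> eval f a b -> eval (PComp f g) n b
| eRec0 f g x a :
    eval f x a -> eval (PRec f g) (cpair x 0) a
| eRecS f g x k a b :
    eval (PRec f g) (cpair x k) a ->
    eval g (cpair x (cpair k a)) b ->
    eval (PRec f g) (cpair x (S k)) b
| eMu f x k :
    eval f (cpair x k) 0 ->
    (forall j, j < k -> exists v, v <> 0 /\ eval f (cpair x j) v) ->
    eval (PMu f) x k.

Definition decidable_pred (P : nat -> Prop) : Prop :=
  exists p : prog, forall n,
    (P n -> eval p n 1) /\ (~ P n -> eval p n 0).

Section Monoid.
Variables (M : nat -> Prop) (op : nat -> nat -> nat) (e : nat).

Definition is_monoid : Prop :=
  M e /\
  (forall a b, M a -> M b -> M (op a b)) /\
  (forall a b c, M a -> M b -> M c -> op (op a b) c = op a (op b c)) /\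
  (forall a, M a -> op e a = a /\ op a e = a).

Definition right_cancellative : Prop :=
  forall a b c, M a -> M b -> M c -> op a c = op b c -> a = b.

Definition equalizer (m1 m2 x1 x2 : nat) : Prop :=
  M x1 /\ M x2 /\ op m1 x1 = op m2 x2.

Definition equalizable (m1 m2 : nat) : Prop :=
  exists x1 x2, equalizer m1 m2 x1 x2.

Definition mge (m1 m2 x1 x2 : nat) : Prop :=
  equalizer m1 m2 x1 x2 /\
  forall y1 y2, equalizer m1 m2 y1 y2 ->
    exists x, M x /\ y1 = op x1 x /\ y2 = op x2 x.

Definition mge_monoid : Prop :=
  is_monoid /\ right_cancellative /\
  forall m1 m2, M m1 -> M m2 -> equalizable m1 m2 ->
    exists x1 x2, mge m1 m2 x1 x2.

Definition invertible (m : nat) : Prop :=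
  exists n, M n /\ op m n = e.

(* Effective mge monoid: elements form a recursive subset of nat (equality
   of elements is then equality of naturals, hence decidable), the operation
   is computable, equalizability of pairs is decidable, a computable eta
   returns an mge for each equalizable pair, inverses are computable. *)
Definition effective_mge_monoid : Prop :=
  mge_monoid /\
  decidable_pred M /\
  (exists p : prog, forall a b, M a -> M b -> eval p (cpair a b) (op a b)) /\
  (exists p : prog, forall a b, M a -> M b ->
      (equalizable a b -> eval p (cpair a b) 1) /\
      (~ equalizable a b -> eval p (cpair a b) 0)) /\
  (exists eta : prog, forall a b, M a -> M b -> equalizable a b ->
      exists x1 x2, eval eta (cpair a b) (cpair x1 x2) /\ mge a b x1 x2) /\
  (exists inv : prog, forall m, M m -> invertible m ->
      exists n, eval inv m n /\ M n /\ op m n = e).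

End Monoid.

(* States and letters are natural numbers; Q and Sigma are the (finitely
   many) states / letters mentioned.  A transition (p, a, m, q) reads the
   letter a, outputs the monoid element m, and goes from p to q. *)
Record transducer : Type := Transducer {
  t_init  : list nat;
  t_final : list nat;
  t_delta : list (nat * nat * nat * nat)
}.

Definition wf_transducer (M : nat -> Prop) (T : transducer) : Prop :=
  forall p a m q, In (p, a, m, q) (t_delta T) -> M m.

Inductive path (op : nat -> nat -> nat) (e : nat) (T : transducer)
  : nat -> list nat -> nat -> nat -> Prop :=
| path_nil p : path op e T p [] e p
| path_cons p a m1 r u m2 q :
    In (p, a, m1, r) (t_delta T) ->
    path op e T r u m2 q ->
    path op e T p (a :: u) (op m1 m2) q.

Definition in_language op e (T : transducer) (u : list nat) (m : nat) : Prop :=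
  exists p q, In p (t_init T) /\ In q (t_final T) /\ path op e T p u m q.

Definition functional op e (T : transducer) : Prop :=
  forall u m m', in_language op e T u m -> in_language op e T u m' -> m = m'.

Fixpoint code_list (l : list nat) : nat :=
  match l with
  | [] => 0
  | x :: l' => S (cpair x (code_list l'))
  end.

Definition code_trans (t : nat * nat * nat * nat) : nat :=
  match t with (p, a, m, q) => cpair p (cpair a (cpair m q)) end.

Definition code_transducer (T : transducer) : nat :=
  cpair (code_list (t_init T))
        (cpair (code_list (t_final T)) (code_list (map code_trans (t_delta T)))).

(* Main.v *)
(* A configuration (p, m1, q, m2) records two runs from initial states on a common word, ending
   in states p, q with outputs m1, m2; T is functional iff no reachable configuration has p, q
   final and m1 <> m2.  Words of length at most 2K + 1, with K = |Delta|^2, suffice.  In an mge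
   monoid two pairs (m1, m2) and (n1, n2) equalized by one common pair (c, d) have the same
   equalizers: factor (c, d) through the mge of (n1, n2) and cancel on the right.  So if T is
   functional on short words, induction on the word replaces any pair of co-accessible runs by
   runs of length at most K into the same states with the same equalizers (pigeonhole on pairs of
   states shortens runs, and a short common suffix to final states equalizes both pairs).  At
   final states the short runs have equal outputs, and the equalizer (e, e) transfers this to
   m1 = m2.  The decider enumerates the configurations of
   these short words and looks for a violation; it needs only the operation and membership in M,
   not eta, the equalizability test or inverses. *)

Require Import Defs.
From Stdlib Require Import Arith List Lia ListDec ClassicalEpsilon.
Import ListNotations.
Local Open Scope bool_scope.

(** * Cantor pairing *)

Fixpoint unpair (n : nat) : nat * nat :=
  match n with
  | 0 => (0, 0)
  | S n' => match unpair n' with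
            | (0, y) => (S y, 0)
            | (S x, y) => (x, S y)
            end
  end.

Lemma cpair_succ_r x y : cpair x (S y) = S (cpair (S x) y).
Proof.
  unfold cpair. replace (x + S y) with (S x + y) by lia.
  remember ((S x + y) * S (S x + y) / 2) as z. lia.
Qed.

Lemma cpair_succ_0 y : cpair (S y) 0 = S (cpair 0 y).
Proof.
  unfold cpair. rewrite !Nat.add_0_r, Nat.add_0_l.
  replace (S y * S (S y)) with (y * S y + S y * 2) by lia.
  rewrite Nat.div_add by lia. lia.
Qed.

Lemma cpair_unpair n : cpair (fst (unpair n)) (snd (unpair n)) = n.
Proof.
  induction n as [|n IH]; [reflexivity|].
  simpl. destruct (unpair n) as [[|x] y]; simpl in *.
  - rewrite cpair_succ_0. congruence.
  - rewrite cpair_succ_r. congruence.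
Qed.

Lemma unpair_onto s y : y <= s -> exists n, unpair n = (s - y, y).
Proof.
  revert y. induction s as [|s IHs]; intros y Hy.
  - exists 0. replace y with 0 by lia. reflexivity.
  - induction y as [|y IHy].
    + destruct (IHs s (le_n s)) as [n Hn]. exists (S n). simpl. rewrite Hn, Nat.sub_diag. reflexivity.
    + destruct IHy as [n Hn]; [lia|]. exists (S n). simpl. rewrite Hn.
      replace (S s - y) with (S (s - y)) by lia. reflexivity.
Qed.

Lemma unpair_cpair x y : unpair (cpair x y) = (x, y).
Proof.
  destruct (unpair_onto (x + y) y) as [n Hn]; [lia|].
  replace (x + y - y) with x in Hn by lia.
  pose proof (cpair_unpair n) as E. rewrite Hn in E. simpl in E. rewrite E. exact Hn.
Qed.

Lemma cpair_ge_r x y : y <= cpair x y.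
Proof. unfold cpair. lia. Qed.

Arguments cpair : simpl never.

Definition cfst n := fst (unpair n).
Definition csnd n := snd (unpair n).

Lemma cfst_cpair x y : cfst (cpair x y) = x.
Proof. unfold cfst. rewrite unpair_cpair. reflexivity. Qed.

Lemma csnd_cpair x y : csnd (cpair x y) = y.
Proof. unfold csnd. rewrite unpair_cpair. reflexivity. Qed.

Lemma cpair_cfst_csnd n : cpair (cfst n) (csnd n) = n.
Proof. apply cpair_unpair. Qed.

#[global] Hint Rewrite cfst_cpair csnd_cpair : codes.

Lemma code_list_length l : length l <= code_list l.
Proof. induction l as [|x l IH]; simpl; [lia|]. pose proof (cpair_ge_r x (code_list l)). lia. Qed.

(** * Programs from expressions *)

Definition computes (p : prog) (f : nat -> nat) : Prop := forall n, eval p n (f n).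

Record cfun := CFun { cf_prog : prog; cf_fun :> nat -> nat; cf_spec : computes cf_prog cf_fun }.

Lemma eval_fst n : eval PFst n (cfst n).
Proof. rewrite <- (cpair_cfst_csnd n) at 1. constructor. Qed.

Lemma eval_snd n : eval PSnd n (csnd n).
Proof. rewrite <- (cpair_cfst_csnd n) at 1. constructor. Qed.

Fixpoint pconst (k : nat) : prog :=
  match k with 0 => PZero | S k => PComp PSucc (pconst k) end.

Lemma eval_pconst k n : eval (pconst k) n k.
Proof. induction k; simpl; econstructor; eauto; constructor. Qed.

Inductive expr : Type :=
| EVar
| EConst (k : nat)
| EPair (a b : expr)
| EFst (a : expr)
| ESnd (a : expr)
| ESucc (a : expr)
| EApp (f : cfun) (a : expr).

Fixpoint denote (a : expr) (n : nat) : nat :=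
  match a with
  | EVar => n
  | EConst k => k
  | EPair a b => cpair (denote a n) (denote b n)
  | EFst a => cfst (denote a n)
  | ESnd a => csnd (denote a n)
  | ESucc a => S (denote a n)
  | EApp f a => f (denote a n)
  end.

Fixpoint compile (a : expr) : prog :=
  match a with
  | EVar => PPair PFst PSnd
  | EConst k => pconst k
  | EPair a b => PPair (compile a) (compile b)
  | EFst a => PComp PFst (compile a)
  | ESnd a => PComp PSnd (compile a)
  | ESucc a => PComp PSucc (compile a)
  | EApp f a => PComp (cf_prog f) (compile a)
  end.

Lemma compile_spec a : computes (compile a) (denote a).
Proof.
  induction a; intro n; simpl.
  - rewrite <- (cpair_cfst_csnd n) at 2. constructor; [apply eval_fst|apply eval_snd].
  - apply eval_pconst.
  - constructor; auto.
  - econstructor; [apply IHa|apply eval_fst].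
  - econstructor; [apply IHa|apply eval_snd].
  - econstructor; [apply IHa|constructor].
  - econstructor; [apply IHa|apply cf_spec].
Qed.

Definition cfun_of_expr (a : expr) : cfun := CFun (compile a) (denote a) (compile_spec a).

Lemma cfun_of_expr_apply a n : cfun_of_expr a n = denote a n.
Proof. reflexivity. Qed.

Lemma denote_var n : denote EVar n = n.
Proof. reflexivity. Qed.

Lemma denote_const k n : denote (EConst k) n = k.
Proof. reflexivity. Qed.

Lemma denote_pair a b n : denote (EPair a b) n = cpair (denote a n) (denote b n).
Proof. reflexivity. Qed.

Lemma denote_fst a n : denote (EFst a) n = cfst (denote a n).
Proof. reflexivity. Qed.

Lemma denote_snd a n : denote (ESnd a) n = csnd (denote a n).
Proof. reflexivity. Qed.

Lemma denote_succ a n : denote (ESucc a) n = S (denote a n).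
Proof. reflexivity. Qed.

Lemma denote_app f a n : denote (EApp f a) n = f (denote a n).
Proof. reflexivity. Qed.

#[global] Hint Rewrite cfun_of_expr_apply denote_var denote_const denote_pair denote_fst denote_snd
  denote_succ denote_app : codes.

Fixpoint prim_rec (f g : nat -> nat) (x k : nat) : nat :=
  match k with 0 => f x | S k' => g (cpair x (cpair k' (prim_rec f g x k'))) end.

Lemma prim_rec_computes (f g : cfun) :
  computes (PRec (cf_prog f) (cf_prog g)) (fun n => prim_rec f g (cfst n) (csnd n)).
Proof.
  intro n. rewrite <- (cpair_cfst_csnd n) at 1.
  induction (csnd n) as [|k IH]; simpl; econstructor; eauto; apply cf_spec.
Qed.

Definition c_prim_rec (f g : cfun) : cfun :=
  CFun _ _ (prim_rec_computes f g).

Lemma c_prim_rec_spec f g x k : c_prim_rec f g (cpair x k) = prim_rec f g x k.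
Proof. simpl. autorewrite with codes. reflexivity. Qed.

#[global] Hint Rewrite c_prim_rec_spec : codes.
Opaque c_prim_rec.

(* Rewriting with the equations of [denote] and the specifications, rather than [simpl], keeps
   the kernel from unfolding compiled programs when it rechecks the proofs. *)
Ltac crunch :=
  repeat (cbn [prim_rec Nat.pred code_trans]; progress autorewrite with codes);
  cbn [prim_rec Nat.pred code_trans].

Definition c_iter (g : cfun) : cfun :=
  c_prim_rec (cfun_of_expr EVar) (cfun_of_expr (EApp g (ESnd (ESnd EVar)))).

Lemma c_iter_spec g x k : c_iter g (cpair x k) = Nat.iter k g x.
Proof.
  unfold c_iter. crunch. induction k as [|k IH]; crunch; [reflexivity|].
  rewrite IH. reflexivity.
Qed.

Definition c_pred : cfun :=
  cfun_of_expr (EApp (c_prim_rec (cfun_of_expr (EConst 0)) (cfun_of_expr (EFst (ESnd EVar))))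
                     (EPair (EConst 0) EVar)).

Lemma c_pred_spec n : c_pred n = pred n.
Proof. unfold c_pred. crunch. destruct n; crunch; reflexivity. Qed.

Definition c_is_zero : cfun :=
  cfun_of_expr (EApp (c_prim_rec (cfun_of_expr (EConst 1)) (cfun_of_expr (EConst 0)))
                     (EPair (EConst 0) EVar)).

Lemma c_is_zero_spec n : c_is_zero n = Nat.b2n (n =? 0).
Proof. unfold c_is_zero. crunch. destruct n; reflexivity. Qed.

Definition c_cond : cfun :=
  cfun_of_expr (EApp (c_prim_rec (cfun_of_expr (ESnd EVar)) (cfun_of_expr (EFst (EFst EVar))))
                     (EPair (ESnd EVar) (EFst EVar))).

Lemma c_cond_spec c x y : c_cond (cpair c (cpair x y)) = match c with 0 => y | S _ => x end.
Proof. unfold c_cond. crunch. destruct c; crunch; reflexivity. Qed.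

#[global] Hint Rewrite c_iter_spec c_pred_spec c_is_zero_spec c_cond_spec : codes.
Opaque c_iter c_pred c_is_zero c_cond.

Definition c_add : cfun := c_iter (cfun_of_expr (ESucc EVar)).

Lemma c_add_spec a b : c_add (cpair a b) = a + b.
Proof.
  unfold c_add. crunch. induction b as [|b IH]; [simpl; lia|].
  rewrite Nat.iter_succ, IH. crunch. lia.
Qed.

Definition c_sub : cfun := c_iter c_pred.

Lemma c_sub_spec a b : c_sub (cpair a b) = a - b.
Proof.
  unfold c_sub. crunch. induction b as [|b IH]; [simpl; lia|].
  rewrite Nat.iter_succ, IH. crunch. lia.
Qed.

#[global] Hint Rewrite c_add_spec c_sub_spec : codes.
Opaque c_add c_sub.

Definition c_mul : cfun :=
  c_prim_rec (cfun_of_expr (EConst 0))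
             (cfun_of_expr (EApp c_add (EPair (EFst EVar) (ESnd (ESnd EVar))))).

Lemma c_mul_spec a b : c_mul (cpair a b) = a * b.
Proof. unfold c_mul. crunch. induction b; crunch; lia. Qed.

Definition c_eqb : cfun :=
  cfun_of_expr (EApp c_is_zero
    (EApp c_add (EPair (EApp c_sub EVar) (EApp c_sub (EPair (ESnd EVar) (EFst EVar)))))).

Lemma c_eqb_spec a b : c_eqb (cpair a b) = Nat.b2n (a =? b).
Proof.
  unfold c_eqb. crunch.
  destruct (Nat.eqb_spec a b), (Nat.eqb_spec (a - b + (b - a)) 0); simpl; lia.
Qed.

#[global] Hint Rewrite c_mul_spec c_eqb_spec : codes.
Opaque c_mul c_eqb.

(** * List processing *)

Notation ECond c a b := (EApp c_cond (EPair c (EPair a b))).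

(* One step of a left fold over a coded list [S (cpair x r)]; as [length l <= code_list l],
   [code_list l] steps exhaust [l]. *)
Definition c_fold_step (step : cfun) : cfun :=
  let head_tail := EApp c_pred (EFst (ESnd EVar)) in
  cfun_of_expr (ECond (EFst (ESnd EVar))
    (EPair (EFst EVar)
       (EPair (ESnd head_tail)
              (EApp step (EPair (EFst EVar) (EPair (EFst head_tail) (ESnd (ESnd EVar)))))))
    EVar).

Lemma c_fold_step_nil step env acc :
  c_fold_step step (cpair env (cpair 0 acc)) = cpair env (cpair 0 acc).
Proof. unfold c_fold_step. crunch. reflexivity. Qed.

Lemma c_fold_step_cons step env x r acc :
  c_fold_step step (cpair env (cpair (S (cpair x r)) acc)) =
  cpair env (cpair r (step (cpair env (cpair x acc)))).
Proof. unfold c_fold_step. crunch. reflexivity. Qed.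

Opaque c_fold_step.

Lemma iter_c_fold_step step env l acc k : length l <= k ->
  Nat.iter k (c_fold_step step) (cpair env (cpair (code_list l) acc)) =
  cpair env (cpair 0 (fold_left (fun a x => step (cpair env (cpair x a))) l acc)).
Proof.
  revert acc k. induction l as [|x l IH]; intros acc k Hk; simpl.
  - induction k as [|k IHk]; [reflexivity|].
    rewrite Nat.iter_succ, IHk by (simpl; lia). apply c_fold_step_nil.
  - destruct k as [|k]; [simpl in Hk; lia|].
    rewrite Nat.iter_succ_r, c_fold_step_cons. apply IH. simpl in Hk. lia.
Qed.

Definition c_fold (step : cfun) : cfun :=
  cfun_of_expr (ESnd (ESnd (EApp (c_iter (c_fold_step step)) (EPair EVar (EFst (ESnd EVar)))))).

Lemma c_fold_spec step env l acc :
  c_fold step (cpair env (cpair (code_list l) acc)) =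
  fold_left (fun a x => step (cpair env (cpair x a))) l acc.
Proof.
  unfold c_fold. crunch. rewrite iter_c_fold_step by apply code_list_length. crunch. reflexivity.
Qed.

Opaque c_fold.

Definition c_rev_append : cfun :=
  cfun_of_expr (EApp (c_fold (cfun_of_expr (ESucc (ESnd EVar)))) (EPair (EConst 0) EVar)).

Lemma c_rev_append_spec l acc :
  c_rev_append (cpair (code_list l) (code_list acc)) = code_list (rev_append l acc).
Proof.
  unfold c_rev_append. crunch. rewrite c_fold_spec.
  revert acc. induction l as [|x l IH]; intro acc; [reflexivity|].
  cbn [fold_left rev_append]. rewrite <- (IH (x :: acc)). f_equal. crunch. reflexivity.
Qed.

#[global] Hint Rewrite c_rev_append_spec : codes.
Opaque c_rev_append.

Definition c_append : cfun :=
  cfun_of_expr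
    (EApp c_rev_append (EPair (EApp c_rev_append (EPair (EFst EVar) (EConst 0))) (ESnd EVar))).

Lemma c_append_spec l l' : c_append (cpair (code_list l) (code_list l')) = code_list (l ++ l').
Proof.
  unfold c_append. crunch. change 0 with (code_list []). autorewrite with codes.
  rewrite !rev_append_rev, app_nil_r, rev_involutive. reflexivity.
Qed.

#[global] Hint Rewrite c_append_spec : codes.
Opaque c_append.

Definition c_flat_map (f : cfun) : cfun :=
  cfun_of_expr (EApp (c_fold (cfun_of_expr
      (EApp c_append (EPair (ESnd (ESnd EVar)) (EApp f (EPair (EFst EVar) (EFst (ESnd EVar))))))))
    (EPair (EFst EVar) (EPair (ESnd EVar) (EConst 0)))).

Lemma c_flat_map_spec {A B} (f : cfun) (codeA : A -> nat) (codeB : B -> nat) (g : A -> list B) env l :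
  (forall x, In x l -> f (cpair env (codeA x)) = code_list (map codeB (g x))) ->
  c_flat_map f (cpair env (code_list (map codeA l))) = code_list (map codeB (flat_map g l)).
Proof.
  intro Hf. unfold c_flat_map. crunch. rewrite c_fold_spec.
  change 0 with (code_list (map codeB [])). rewrite <- (app_nil_l (flat_map g l)).
  generalize (@nil B) as acc.
  induction l as [|x l IH]; intro acc; cbn [map flat_map fold_left]; [rewrite app_nil_r; reflexivity|].
  rewrite app_assoc, <- (IH (fun y Hy => Hf y (or_intror Hy))). f_equal.
  crunch. rewrite Hf by (left; reflexivity). crunch. now rewrite map_app.
Qed.

Opaque c_flat_map.

Definition c_flat_map2 (f : cfun) : cfun :=
  cfun_of_expr (EApp (c_flat_map (cfun_of_expr
      (EApp (c_flat_map f) (EPair (EPair (EFst (EFst EVar)) (ESnd EVar)) (ESnd (EFst EVar))))))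
    (EPair (EPair (EFst EVar) (ESnd (ESnd EVar))) (EFst (ESnd EVar)))).

Lemma c_flat_map2_spec {A1 A2 B} (f : cfun) (code1 : A1 -> nat) (code2 : A2 -> nat) (codeB : B -> nat)
    (g : A1 -> A2 -> list B) env l1 l2 :
  (forall x y, In x l1 -> In y l2 ->
     f (cpair (cpair env (code1 x)) (code2 y)) = code_list (map codeB (g x y))) ->
  c_flat_map2 f (cpair env (cpair (code_list (map code1 l1)) (code_list (map code2 l2)))) =
  code_list (map codeB (flat_map (fun x => flat_map (g x) l2) l1)).
Proof.
  intro Hf. unfold c_flat_map2. crunch.
  apply c_flat_map_spec. intros x Hx. crunch. apply c_flat_map_spec. auto.
Qed.

Opaque c_flat_map2.

(** * The decision procedure *)

(* A configuration (p, m1, q, m2) is coded by [code_trans], like a transition. *)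
Notation quad := (nat * nat * nat * nat)%type.

Section Algorithm.
Variables (mul : nat -> nat -> nat) (e : nat).

Definition step_pair (c t1 t2 : quad) : list quad :=
  let '(p, m1, q, m2) := c in
  let '(p1, a1, x1, q1) := t1 in
  let '(p2, a2, x2, q2) := t2 in
  if (p1 =? p) && (p2 =? q) && (a1 =? a2) then [(q1, mul m1 x1, q2, mul m2 x2)] else [].

Definition successors (delta : list quad) (c : quad) : list quad :=
  flat_map (fun t1 => flat_map (step_pair c t1) delta) delta.

(* Keeping [c] makes the [k]-th iterate from [initial] collect the configurations of all words
   of length at most [k]. *)
Definition expand (delta : list quad) (R : list quad) : list quad :=
  flat_map (fun c => c :: successors delta c) R.

Definition initial (I : list nat) : list quad :=
  flat_map (fun i => flat_map (fun i' => [(i, e, i', e)]) I) I.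

Definition violation (c : quad) (f f' : nat) : list quad :=
  let '(p, m1, q, m2) := c in
  if (p =? f) && (q =? f') && negb (m1 =? m2) then [c] else [].

Definition violations (F : list nat) (R : list quad) : list quad :=
  flat_map (fun c => flat_map (fun f => flat_map (violation c f) F) F) R.

Lemma in_successors delta p m1 q m2 c :
  In c (successors delta (p, m1, q, m2)) <->
  exists a x1 x2 q1 q2, In (p, a, x1, q1) delta /\ In (q, a, x2, q2) delta /\
                        c = (q1, mul m1 x1, q2, mul m2 x2).
Proof.
  unfold successors. rewrite in_flat_map. split.
  - intros ([[[p1 a1] x1] q1] & H1 & H). apply in_flat_map in H as ([[[p2 a2] x2] q2] & H2 & H).
    simpl in H. destruct (p1 =? p) eqn:E1, (p2 =? q) eqn:E2, (a1 =? a2) eqn:E3;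
      simpl in H; try contradiction.
    apply Nat.eqb_eq in E1, E2, E3. subst. destruct H as [<- | []]. eauto 10.
  - intros (a & x1 & x2 & q1 & q2 & H1 & H2 & ->). exists (p, a, x1, q1). split; [exact H1|].
    apply in_flat_map. exists (q, a, x2, q2). split; [exact H2|].
    simpl. rewrite !Nat.eqb_refl. left. reflexivity.
Qed.

Lemma in_expand delta R c :
  In c (expand delta R) <-> In c R \/ exists c0, In c0 R /\ In c (successors delta c0).
Proof.
  unfold expand. rewrite in_flat_map. split.
  - intros (c0 & H0 & [<- | H]); eauto.
  - intros [H | (c0 & H0 & H)]; eexists; split; eauto; simpl; auto.
Qed.

Lemma in_initial I c : In c (initial I) <-> exists i i', In i I /\ In i' I /\ c = (i, e, i', e).
Proof.
  unfold initial. rewrite in_flat_map. split.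
  - intros (i & Hi & H). apply in_flat_map in H as (i' & Hi' & [<- | []]). eauto.
  - intros (i & i' & Hi & Hi' & ->). exists i. split; [exact Hi|].
    apply in_flat_map. exists i'. simpl. auto.
Qed.

Lemma violations_nil F R :
  violations F R = [] <-> forall p m1 q m2, In (p, m1, q, m2) R -> In p F -> In q F -> m1 = m2.
Proof.
  assert (Hnil : forall l : list quad, l = [] <-> forall c, ~ In c l)
    by (intros [|c l]; split; simpl; eauto; intros H; [discriminate | destruct (H c); auto]).
  rewrite Hnil. unfold violations. split.
  - intros H p m1 q m2 Hc Hp Hq. destruct (Nat.eq_dec m1 m2) as [E | E]; [exact E|].
    exfalso. apply (H (p, m1, q, m2)). apply in_flat_map. exists (p, m1, q, m2). split; [exact Hc|].
    apply in_flat_map. exists p. split; [exact Hp|]. apply in_flat_map. exists q. split; [exact Hq|].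
    simpl. rewrite !Nat.eqb_refl. apply Nat.eqb_neq in E. rewrite E. left. reflexivity.
  - intros H c Hc. apply in_flat_map in Hc as ([[[p m1] q] m2] & HR & Hc).
    apply in_flat_map in Hc as (f & Hf & Hc). apply in_flat_map in Hc as (f' & Hf' & Hc).
    simpl in Hc. destruct (p =? f) eqn:E1, (q =? f') eqn:E2, (m1 =? m2) eqn:E3;
      simpl in Hc; try contradiction.
    apply Nat.eqb_eq in E1, E2. apply Nat.eqb_neq in E3. subst. eauto.
Qed.

End Algorithm.

Notation EEqb a b := (EApp c_eqb (EPair a b)).
Notation EAnd a b := (ECond a b (EConst 0)).
Notation ESingleton a := (ESucc (EPair a (EConst 0))).
Notation EQuad a b c d := (EPair a (EPair b (EPair c d))).
Notation EQuad1 a := (EFst a).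
Notation EQuad2 a := (EFst (ESnd a)).
Notation EQuad3 a := (EFst (ESnd (ESnd a))).
Notation EQuad4 a := (ESnd (ESnd (ESnd a))).

Definition code_quads (l : list quad) : nat := code_list (map code_trans l).

Section Programs.
Variables (cmul : cfun) (e : nat).

Let mul a b := cmul (cpair a b).

Definition c_step_pair : cfun :=
  let c := EFst (EFst EVar) in let t1 := ESnd (EFst EVar) in let t2 := ESnd EVar in
  cfun_of_expr
    (ECond (EAnd (EEqb (EQuad1 t1) (EQuad1 c))
                 (EAnd (EEqb (EQuad1 t2) (EQuad3 c)) (EEqb (EQuad2 t1) (EQuad2 t2))))
       (ESingleton (EQuad (EQuad4 t1) (EApp cmul (EPair (EQuad2 c) (EQuad3 t1)))
                          (EQuad4 t2) (EApp cmul (EPair (EQuad4 c) (EQuad3 t2)))))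
       (EConst 0)).

Lemma c_step_pair_spec c t1 t2 :
  c_step_pair (cpair (cpair (code_trans c) (code_trans t1)) (code_trans t2)) =
  code_quads (step_pair mul c t1 t2).
Proof.
  destruct c as [[[p m1] q] m2], t1 as [[[p1 a1] x1] q1], t2 as [[[p2 a2] x2] q2].
  unfold c_step_pair. crunch. cbn [step_pair].
  destruct (p1 =? p), (p2 =? q), (a1 =? a2); reflexivity.
Qed.

Opaque c_step_pair.

Definition c_successors : cfun :=
  cfun_of_expr (EApp (c_flat_map2 c_step_pair) (EPair (ESnd EVar) (EPair (EFst EVar) (EFst EVar)))).

Lemma c_successors_spec delta c :
  c_successors (cpair (code_quads delta) (code_trans c)) = code_quads (successors mul delta c).
Proof.
  unfold c_successors. crunch. apply c_flat_map2_spec. intros. apply c_step_pair_spec.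
Qed.

Opaque c_successors.

Definition c_expand : cfun :=
  cfun_of_expr
    (EApp (c_flat_map (cfun_of_expr (ESucc (EPair (ESnd EVar) (EApp c_successors EVar))))) EVar).

Lemma c_expand_spec delta R :
  c_expand (cpair (code_quads delta) (code_quads R)) = code_quads (expand mul delta R).
Proof.
  unfold c_expand. crunch. apply c_flat_map_spec. intros c _. crunch.
  rewrite c_successors_spec. reflexivity.
Qed.

Opaque c_expand.

Definition c_initial : cfun :=
  let pair_config := ESingleton (EQuad (ESnd (EFst EVar)) (EConst e) (ESnd EVar) (EConst e)) in
  cfun_of_expr (EApp (c_flat_map2 (cfun_of_expr pair_config)) (EPair (EConst 0) (EPair EVar EVar))).

Lemma c_initial_spec I : c_initial (code_list I) = code_quads (initial e I).
Proof.
  unfold c_initial. crunch.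
  replace (code_list I) with (code_list (map (fun i => i) I)) by now rewrite map_id.
  apply c_flat_map2_spec. intros. crunch. reflexivity.
Qed.

Opaque c_initial.

Definition c_violation : cfun :=
  let c := EFst (EFst EVar) in let f := ESnd (EFst EVar) in let f' := ESnd EVar in
  cfun_of_expr
    (ECond (EAnd (EEqb (EQuad1 c) f) (EEqb (EQuad3 c) f'))
       (ECond (EEqb (EQuad2 c) (EQuad4 c)) (EConst 0) (ESingleton c))
       (EConst 0)).

Lemma c_violation_spec c f f' :
  c_violation (cpair (cpair (code_trans c) f) f') = code_quads (violation c f f').
Proof.
  destruct c as [[[p m1] q] m2]. unfold c_violation. crunch. cbn [violation].
  destruct (p =? f), (q =? f'), (m1 =? m2); reflexivity.
Qed.

Opaque c_violation.

Definition c_violations : cfun :=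
  cfun_of_expr (EApp (c_flat_map (cfun_of_expr
      (EApp (c_flat_map2 c_violation) (EPair (ESnd EVar) (EPair (EFst EVar) (EFst EVar)))))) EVar).

Lemma c_violations_spec F R :
  c_violations (cpair (code_list F) (code_quads R)) = code_quads (violations F R).
Proof.
  unfold c_violations. crunch. apply c_flat_map_spec. intros c _. crunch.
  replace (code_list F) with (code_list (map (fun f => f) F)) by now rewrite map_id.
  apply c_flat_map2_spec. intros. apply c_violation_spec.
Qed.

Opaque c_violations.

Definition c_expand_state : cfun := cfun_of_expr (EPair (EFst EVar) (EApp c_expand EVar)).

Lemma c_expand_state_spec delta R :
  c_expand_state (cpair (code_quads delta) (code_quads R)) =
  cpair (code_quads delta) (code_quads (expand mul delta R)).
Proof. unfold c_expand_state. crunch. rewrite c_expand_spec. reflexivity. Qed.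

Opaque c_expand_state.

Lemma iter_c_expand_state delta R k :
  Nat.iter k c_expand_state (cpair (code_quads delta) (code_quads R)) =
  cpair (code_quads delta) (code_quads (Nat.iter k (expand mul delta) R)).
Proof.
  induction k as [|k IH]; [reflexivity|].
  rewrite !Nat.iter_succ, IH. apply c_expand_state_spec.
Qed.

Definition search_bound (T : transducer) : nat :=
  let d := code_quads (t_delta T) in S (d * d + d * d).

Definition c_decider : cfun :=
  let I := EFst EVar in let F := EFst (ESnd EVar) in let D := ESnd (ESnd EVar) in
  let DD := EApp c_mul (EPair D D) in
  let reach := ESnd (EApp (c_iter c_expand_state)
                          (EPair (EPair D (EApp c_initial I)) (ESucc (EApp c_add (EPair DD DD))))) in
  cfun_of_expr (EApp c_is_zero (EApp c_violations (EPair F reach))).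

Lemma c_decider_spec T :
  c_decider (code_transducer T) =
  match violations (t_final T)
          (Nat.iter (search_bound T) (expand mul (t_delta T)) (initial e (t_init T))) with
  | [] => 1
  | _ :: _ => 0
  end.
Proof.
  unfold c_decider, code_transducer. crunch.
  rewrite c_initial_spec. fold (code_quads (t_delta T)).
  rewrite iter_c_expand_state. crunch. rewrite c_violations_spec.
  unfold code_quads. destruct violations; reflexivity.
Qed.

End Programs.

(** * Runs *)

Section Walks.
Variables (A : Type) (step : A -> A -> Prop).

Inductive walk : A -> list A -> A -> Prop :=
| walk_nil s : walk s [] s
| walk_cons s s1 l s' : step s s1 -> walk s1 l s' -> walk s (s1 :: l) s'.

Lemma walk_app s l1 s1 l2 s' : walk s l1 s1 -> walk s1 l2 s' -> walk s (l1 ++ l2) s'.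
Proof. induction 1; intro H2; simpl; auto. econstructor; eauto. Qed.

Lemma walk_split l1 x l2 s s' : walk s (l1 ++ x :: l2) s' -> walk s (l1 ++ [x]) x /\ walk x l2 s'.
Proof.
  revert s. induction l1 as [|y l1 IH]; intros s H; inversion H as [|? ? ? ? Hstep Hw]; subst.
  - split; [econstructor; eauto; constructor | assumption].
  - destruct (IH _ Hw). split; [econstructor|]; eauto.
Qed.

Variable V : list A.
Hypothesis step_in_V : forall s s', step s s' -> In s' V.
Hypothesis A_eq_dec : forall x y : A, {x = y} + {x <> y}.

Lemma walk_in_V s l s' : walk s l s' -> incl l V.
Proof. induction 1; intros y Hy; [destruct Hy|]. destruct Hy as [<- | Hy]; eauto. Qed.

Lemma walk_shorten s l s' : walk s l s' -> exists l', length l' <= length V /\ walk s l' s'.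
Proof.
  remember (length l) as n eqn:Hn. revert s l s' Hn.
  induction n as [n IH] using lt_wf_ind. intros s l s' -> Hw.
  destruct (le_lt_dec (length l) (length V)) as [Hle | Hgt]; [eauto|].
  assert (Hdup : ~ NoDup l).
  { intro Hnd. pose proof (NoDup_incl_length Hnd (walk_in_V _ _ _ Hw)). lia. }
  assert (Hdec : decidable_eq A) by (intros x y; destruct (A_eq_dec x y); [left | right]; assumption).
  destruct (not_NoDup Hdec Hdup) as (x & l1 & l2 & l3 & ->).
  apply (walk_split l1 x (l2 ++ x :: l3)) in Hw as [Hw1 Hw2].
  apply (walk_split l2 x l3) in Hw2 as [_ Hw3].
  refine (IH _ _ s ((l1 ++ [x]) ++ l3) s' eq_refl (walk_app _ _ _ _ _ Hw1 Hw3)).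
  rewrite !length_app. simpl. rewrite length_app. simpl. lia.
Qed.

End Walks.

Section Runs.
Variables (M : nat -> Prop) (op : nat -> nat -> nat) (e : nat) (T : transducer).
Hypothesis unit_in : M e.
Hypothesis op_closed : forall a b, M a -> M b -> M (op a b).
Hypothesis op_assoc : forall a b c, M a -> M b -> M c -> op (op a b) c = op a (op b c).
Hypothesis op_unit : forall a, M a -> op e a = a /\ op a e = a.
Hypothesis T_wf : wf_transducer M T.

Notation path := (path op e T).
Notation delta := (t_delta T).

Lemma path_output_in p u m q : path p u m q -> M m.
Proof. induction 1; auto. apply op_closed; auto. eapply T_wf; eauto. Qed.

Lemma path_nil_inv p m q : path p [] m q -> m = e /\ p = q.
Proof. intro H. inversion H; auto. Qed.

Lemma path_app p u m r w c f : path p u m r -> path r w c f -> path p (u ++ w) (op m c) f.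
Proof.
  intros H1 H2. induction H1 as [p|p a x r' u m2 q Hx H1 IH]; simpl.
  - destruct (op_unit _ (path_output_in _ _ _ _ H2)) as [-> _]. exact H2.
  - rewrite op_assoc; [econstructor; eauto | eapply T_wf; eauto | eapply path_output_in; eauto
                      | eapply path_output_in; eauto].
Qed.

Lemma path_snoc p u m r a x q : path p u m r -> In (r, a, x, q) delta -> path p (u ++ [a]) (op m x) q.
Proof.
  intros H Hx. apply (path_app _ _ _ _ _ _ _ H).
  assert (Hlast : path r [a] (op x e) q) by (econstructor; [exact Hx | constructor]).
  rewrite (proj2 (op_unit x (T_wf _ _ _ _ Hx))) in Hlast. exact Hlast.
Qed.

Lemma path_snoc_inv p u a m q : path p (u ++ [a]) m q ->
  exists r m' x, path p u m' r /\ In (r, a, x, q) delta /\ m = op m' x.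
Proof.
  revert p m. induction u as [|b u IH]; intros p m H; simpl in H.
  - inversion H as [|? ? x ? ? ? ? Hx Hnil]; subst. apply path_nil_inv in Hnil as [-> ->].
    exists p, e, x. split; [constructor|]. split; [exact Hx|].
    destruct (op_unit x (T_wf _ _ _ _ Hx)). congruence.
  - inversion H as [|? ? x ? ? ? ? Hx Hu]; subst. destruct (IH _ _ Hu) as (r' & m' & y & Hm' & Hy & ->).
    exists r', (op x m'), y. split; [econstructor; eauto|]. split; [exact Hy|].
    symmetry. apply op_assoc; [eapply T_wf | eapply path_output_in | eapply T_wf]; eauto.
Qed.

Definition joint_step (s s' : nat * nat) : Prop :=
  exists a x1 x2, In (fst s, a, x1, fst s') delta /\ In (snd s, a, x2, snd s') delta.

Lemma paths_joint_walk p u m1 p' q m2 q' : path p u m1 p' -> path q u m2 q' ->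
  exists l, walk _ joint_step (p, q) l (p', q').
Proof.
  intro H1. revert q m2. induction H1 as [p|p a x1 r u m1 p' Hx1 H1 IH]; intros q m2 H2.
  - apply path_nil_inv in H2 as [_ ->]. exists []. constructor.
  - inversion H2 as [|? ? x2 r2 ? ? ? Hx2 H2']; subst. destruct (IH _ _ H2') as [l Hl].
    exists ((r, r2) :: l). econstructor; [|exact Hl]. exists a, x1, x2. auto.
Qed.

Lemma joint_walk_paths s l s' : walk _ joint_step s l s' ->
  exists u m1 m2, length u = length l /\ path (fst s) u m1 (fst s') /\ path (snd s) u m2 (snd s').
Proof.
  induction 1 as [s|s s1 l s' Hs _ (u & m1 & m2 & Hl & H1 & H2)].
  - exists [], e, e. repeat split; constructor.
  - destruct Hs as (a & x1 & x2 & Hx1 & Hx2).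
    exists (a :: u), (op x1 m1), (op x2 m2). repeat split; [simpl; auto | econstructor; eauto ..].
Qed.

Lemma paths_shorten p u m1 p' q m2 q' : path p u m1 p' -> path q u m2 q' ->
  exists u' n1 n2, length u' <= length delta * length delta /\ path p u' n1 p' /\ path q u' n2 q'.
Proof.
  intros H1 H2. destruct (paths_joint_walk _ _ _ _ _ _ _ H1 H2) as [l Hl].
  set (targets := map (fun t : nat * nat * nat * nat => let '(_, _, _, q) := t in q) delta).
  assert (Hstep : forall s s', joint_step s s' -> In s' (list_prod targets targets)).
  { intros [r1 r2] [r1' r2'] (a & x1 & x2 & Hx1 & Hx2).
    apply in_prod; apply in_map_iff; eexists; split; [|exact Hx1| |exact Hx2]; reflexivity. }
  assert (Hdec : forall s s' : nat * nat, {s = s'} + {s <> s'}) by (decide equality; apply Nat.eq_dec).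
  destruct (walk_shorten _ _ _ Hstep Hdec _ _ _ Hl) as (l' & Hlen & Hl').
  destruct (joint_walk_paths _ _ _ Hl') as (u' & n1 & n2 & Hu & H1' & H2').
  exists u', n1, n2. unfold targets in Hlen. rewrite length_prod, length_map in Hlen. rewrite Hu. auto.
Qed.

End Runs.

(** * Equalizers in an mge monoid *)

Section Equalizers.
Variables (M : nat -> Prop) (op : nat -> nat -> nat).
Hypothesis op_closed : forall a b, M a -> M b -> M (op a b).
Hypothesis op_assoc : forall a b c, M a -> M b -> M c -> op (op a b) c = op a (op b c).
Hypothesis op_rcancel : right_cancellative M op.
Hypothesis mge_exists : forall m1 m2, M m1 -> M m2 -> equalizable M op m1 m2 ->
  exists x1 x2, mge M op m1 m2 x1 x2.

Definition same_equalizers (m1 m2 n1 n2 : nat) : Prop :=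
  forall y1 y2, M y1 -> M y2 -> (op m1 y1 = op m2 y2 <-> op n1 y1 = op n2 y2).

Lemma equalizers_incl m1 m2 n1 n2 c d :
  M m1 -> M m2 -> M n1 -> M n2 -> M c -> M d -> op m1 c = op m2 d -> op n1 c = op n2 d ->
  forall y1 y2, M y1 -> M y2 -> op n1 y1 = op n2 y2 -> op m1 y1 = op m2 y2.
Proof.
  intros Mm1 Mm2 Mn1 Mn2 Mc Md Em En y1 y2 My1 My2 Ey.
  destruct (mge_exists n1 n2 Mn1 Mn2) as (z1 & z2 & (Mz1 & Mz2 & Ez) & Hmge);
    [exists c, d; split; auto|].
  destruct (Hmge c d) as (t & Mt & -> & ->); [split; auto|].
  assert (Emz : op m1 z1 = op m2 z2) by (apply (op_rcancel _ _ t); auto; rewrite !op_assoc; auto).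
  destruct (Hmge y1 y2) as (s & Ms & -> & ->); [split; auto|].
  rewrite <- !op_assoc by auto. congruence.
Qed.

Lemma same_equalizers_of_common m1 m2 n1 n2 c d :
  M m1 -> M m2 -> M n1 -> M n2 -> M c -> M d -> op m1 c = op m2 d -> op n1 c = op n2 d ->
  same_equalizers m1 m2 n1 n2.
Proof.
  intros Mm1 Mm2 Mn1 Mn2 Mc Md Em En y1 y2 My1 My2.
  split; [apply (equalizers_incl n1 n2 m1 m2 c d) | apply (equalizers_incl m1 m2 n1 n2 c d)]; auto.
Qed.

Lemma same_equalizers_mul_r m1 m2 n1 n2 x1 x2 :
  M m1 -> M m2 -> M n1 -> M n2 -> M x1 -> M x2 -> same_equalizers m1 m2 n1 n2 ->
  same_equalizers (op m1 x1) (op m2 x2) (op n1 x1) (op n2 x2).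
Proof. intros; intros y1 y2 ? ?. rewrite !op_assoc by auto. auto. Qed.

End Equalizers.

(** * Functionality on short words *)

Section LengthBound.
Variables (M : nat -> Prop) (op : nat -> nat -> nat) (e : nat) (T : transducer).
Hypothesis unit_in : M e.
Hypothesis op_closed : forall a b, M a -> M b -> M (op a b).
Hypothesis op_assoc : forall a b c, M a -> M b -> M c -> op (op a b) c = op a (op b c).
Hypothesis op_unit : forall a, M a -> op e a = a /\ op a e = a.
Hypothesis op_rcancel : right_cancellative M op.
Hypothesis mge_exists : forall m1 m2, M m1 -> M m2 -> equalizable M op m1 m2 ->
  exists x1 x2, mge M op m1 m2 x1 x2.
Hypothesis T_wf : wf_transducer M T.

Notation path := (path op e T).
Notation delta := (t_delta T).
Let out_in := path_output_in M op e T unit_in op_closed T_wf.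
Let app := path_app M op e T unit_in op_closed op_assoc op_unit T_wf.
Let snoc := path_snoc M op e T unit_in op_closed op_assoc op_unit T_wf.
Let snoc_inv := path_snoc_inv M op e T unit_in op_closed op_assoc op_unit T_wf.

Definition functional_upto (L : nat) : Prop :=
  forall u m m', length u <= L -> in_language op e T u m -> in_language op e T u m' -> m = m'.

Definition coaccessible (p q : nat) : Prop :=
  exists w f f' c d, In f (t_final T) /\ In f' (t_final T) /\ path p w c f /\ path q w d f'.

Let K := length delta * length delta.

Lemma coaccessible_pred r1 r2 a x1 x2 p q :
  In (r1, a, x1, p) delta -> In (r2, a, x2, q) delta -> coaccessible p q -> coaccessible r1 r2.
Proof.
  intros H1 H2 (w & f & f' & c & d & Hf & Hf' & P1 & P2).
  exists (a :: w), f, f', (op x1 c), (op x2 d). repeat split; auto; econstructor; eauto.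
Qed.

Lemma shorten_coaccessible_runs (Hb : functional_upto (2 * K + 1)) i i' v n1 n2 p q :
  In i (t_init T) -> In i' (t_init T) -> length v <= S K ->
  path i v n1 p -> path i' v n2 q -> coaccessible p q ->
  exists v' k1 k2, length v' <= K /\ path i v' k1 p /\ path i' v' k2 q /\
                   same_equalizers M op n1 n2 k1 k2.
Proof.
  intros Hi Hi' Hv P1 P2 (w & f & f' & c & d & Hf & Hf' & W1 & W2).
  destruct (paths_shorten _ _ _ _ _ _ _ _ _ _ P1 P2) as (v' & k1 & k2 & Hv' & Q1 & Q2).
  destruct (paths_shorten _ _ _ _ _ _ _ _ _ _ W1 W2) as (w' & c' & d' & Hw' & W1' & W2').
  assert (En : op n1 c' = op n2 d').
  { apply (Hb (v ++ w')); [rewrite length_app; unfold K in *; lia | exists i, f | exists i', f'];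
      repeat split; auto; eapply app; eauto. }
  assert (Ek : op k1 c' = op k2 d').
  { apply (Hb (v' ++ w')); [rewrite length_app; unfold K in *; lia | exists i, f | exists i', f'];
      repeat split; auto; eapply app; eauto. }
  exists v', k1, k2. split; [exact Hv'|]. split; [exact Q1|]. split; [exact Q2|].
  apply (same_equalizers_of_common M op op_closed op_assoc op_rcancel mge_exists _ _ _ _ c' d' );
    auto; eapply out_in; eauto.
Qed.

Lemma short_equivalent_runs (Hb : functional_upto (2 * K + 1)) i i' v : forall p q m1 m2,
  In i (t_init T) -> In i' (t_init T) -> path i v m1 p -> path i' v m2 q -> coaccessible p q ->
  exists v' n1 n2, length v' <= K /\ path i v' n1 p /\ path i' v' n2 q /\
                   same_equalizers M op m1 m2 n1 n2.
Proof.
  induction v as [|a v IH] using rev_ind; intros p q m1 m2 Hi Hi' P1 P2 Hc.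
  - exists [], m1, m2. split; [simpl; lia|]. split; [exact P1|]. split; [exact P2|].
    intros y1 y2 _ _. reflexivity.
  - destruct (snoc_inv _ _ _ _ _ P1) as (r1 & m1' & x1 & P1' & T1 & ->).
    destruct (snoc_inv _ _ _ _ _ P2) as (r2 & m2' & x2 & P2' & T2 & ->).
    destruct (IH r1 r2 m1' m2' Hi Hi' P1' P2' (coaccessible_pred _ _ _ _ _ _ _ T1 T2 Hc))
      as (v' & n1 & n2 & Hv' & Q1 & Q2 & Hn).
    destruct (shorten_coaccessible_runs Hb i i' (v' ++ [a]) (op n1 x1) (op n2 x2) p q Hi Hi'
                ltac:(rewrite length_app; simpl; lia)
                (snoc _ _ _ _ _ _ _ Q1 T1) (snoc _ _ _ _ _ _ _ Q2 T2) Hc)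
      as (v'' & k1 & k2 & Hv'' & R1 & R2 & Hk).
    exists v'', k1, k2. split; [exact Hv''|]. split; [exact R1|]. split; [exact R2|].
    assert (M x1 /\ M x2) as [Mx1 Mx2] by (split; eapply T_wf; eauto).
    intros y1 y2 My1 My2. rewrite <- (Hk y1 y2 My1 My2).
    apply (same_equalizers_mul_r M op op_closed op_assoc); auto; eapply out_in; eauto.
Qed.

Theorem functional_of_functional_upto : functional_upto (2 * K + 1) -> functional op e T.
Proof.
  intros Hb u m m' (i & f & Hi & Hf & P1) (i' & f' & Hi' & Hf' & P2).
  destruct (short_equivalent_runs Hb i i' u f f' m m' Hi Hi' P1 P2) as (v & n1 & n2 & Hv & Q1 & Q2 & Hn).
  { exists [], f, f', e, e. repeat split; auto; constructor. }
  assert (n1 = n2) as <- by (apply (Hb v); [lia | exists i, f | exists i', f']; auto).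
  destruct (op_unit m (out_in _ _ _ _ P1)), (op_unit m' (out_in _ _ _ _ P2)).
  assert (op m e = op m' e) by (apply Hn; auto). congruence.
Qed.

End LengthBound.

(** * Correctness *)

Section Correctness.
Variables (M : nat -> Prop) (op : nat -> nat -> nat) (e : nat) (T : transducer).
Variable mul : nat -> nat -> nat.
Hypothesis unit_in : M e.
Hypothesis op_closed : forall a b, M a -> M b -> M (op a b).
Hypothesis op_assoc : forall a b c, M a -> M b -> M c -> op (op a b) c = op a (op b c).
Hypothesis op_unit : forall a, M a -> op e a = a /\ op a e = a.
Hypothesis op_rcancel : right_cancellative M op.
Hypothesis mge_exists : forall m1 m2, M m1 -> M m2 -> equalizable M op m1 m2 ->
  exists x1 x2, mge M op m1 m2 x1 x2.
Hypothesis T_wf : wf_transducer M T.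
Hypothesis mul_op : forall a b, M a -> M b -> mul a b = op a b.

Notation path := (path op e T).
Notation delta := (t_delta T).

Let out_in := path_output_in M op e T unit_in op_closed T_wf.
Let snoc := path_snoc M op e T unit_in op_closed op_assoc op_unit T_wf.
Let snoc_inv := path_snoc_inv M op e T unit_in op_closed op_assoc op_unit T_wf.

Lemma in_iter_expand k p m1 q m2 :
  In (p, m1, q, m2) (Nat.iter k (expand mul delta) (initial e (t_init T))) <->
  exists u i i', length u <= k /\ In i (t_init T) /\ In i' (t_init T) /\ path i u m1 p /\ path i' u m2 q.
Proof.
  revert p m1 q m2. induction k as [|k IH]; intros p m1 q m2; simpl Nat.iter.
  - rewrite in_initial. split.
    + intros (i & i' & Hi & Hi' & E). injection E as E1 E2 E3 E4.
      exists [], i, i'. subst. repeat split; auto; constructor.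
    + intros ([|] & i & i' & Hu & Hi & Hi' & P1 & P2); [|simpl in Hu; lia].
      apply path_nil_inv in P1 as [-> ->]. apply path_nil_inv in P2 as [-> ->]. eauto 6.
  - rewrite in_expand. split.
    + intros [H | ([[[p0 n1] q0] n2] & H & Hs)].
      * apply IH in H as (u & i & i' & Hu & Hi & Hi' & P1 & P2). exists u, i, i'. repeat split; auto.
      * apply IH in H as (u & i & i' & Hu & Hi & Hi' & P1 & P2).
        apply in_successors in Hs as (a & x1 & x2 & q1 & q2 & T1 & T2 & [= -> -> -> ->]).
        exists (u ++ [a]), i, i'. rewrite length_app. simpl.
        rewrite !mul_op by (solve [eapply out_in; eauto | eapply T_wf; eauto]).
        repeat split; auto; [lia | eapply snoc | eapply snoc]; eauto.
    + intros (u & i & i' & Hu & Hi & Hi' & P1 & P2).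
      destruct u as [|a u] using rev_ind; [left; apply IH; exists [], i, i'; auto with arith|].
      clear IHu.
      destruct (le_lt_dec (length (u ++ [a])) k) as [Hle | Hgt]; [left; apply IH; eauto 8|].
      right. rewrite length_app in Hu, Hgt. simpl in Hu, Hgt.
      destruct (snoc_inv _ _ _ _ _ P1) as (r1 & n1 & x1 & P1' & T1 & ->).
      destruct (snoc_inv _ _ _ _ _ P2) as (r2 & n2 & x2 & P2' & T2 & ->).
      exists (r1, n1, r2, n2). split; [apply IH; exists u, i, i'; repeat split; auto; lia|].
      apply in_successors. exists a, x1, x2, p, q. repeat split; auto.
      rewrite !mul_op by (solve [eapply out_in; eauto | eapply T_wf; eauto]). reflexivity.
Qed.

Lemma functional_upto_iff_no_violation L :
  functional_upto op e T L <->
  violations (t_final T) (Nat.iter L (expand mul delta) (initial e (t_init T))) = [].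
Proof.
  rewrite violations_nil. split.
  - intros Hb p m1 q m2 H Hp Hq. apply in_iter_expand in H as (u & i & i' & Hu & Hi & Hi' & P1 & P2).
    apply (Hb u); [exact Hu | exists i, p | exists i', q]; auto.
  - intros H u m m' Hu (i & f & Hi & Hf & P1) (i' & f' & Hi' & Hf' & P2).
    apply (H f m f' m'); auto. apply in_iter_expand. eauto 10.
Qed.

Lemma functional_iff_no_violation :
  functional op e T <->
  violations (t_final T) (Nat.iter (search_bound T) (expand mul delta) (initial e (t_init T))) = [].
Proof.
  rewrite <- functional_upto_iff_no_violation. split.
  - intros Hf u m m' _. apply Hf.
  - intros Hb. apply (functional_of_functional_upto M op e T); auto.
    intros u m m' Hu. apply Hb. unfold search_bound.
    pose proof (code_list_length (map code_trans delta)) as Hd. rewrite length_map in Hd.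
    unfold code_quads. pose proof (Nat.mul_le_mono _ _ _ _ Hd Hd). lia.
Qed.

End Correctness.

Lemma total_op_computable (M : nat -> Prop) (op : nat -> nat -> nat) :
  decidable_pred M -> (exists p, forall a b, M a -> M b -> eval p (cpair a b) (op a b)) ->
  exists cmul : cfun, forall a b, M a -> M b -> cmul (cpair a b) = op a b.
Proof.
  intros [pM HpM] [pop Hpop].
  set (chi n := if excluded_middle_informative (M n) then 1 else 0).
  assert (Hchi : computes pM chi).
  { intro n. unfold chi. destruct excluded_middle_informative; apply HpM; assumption. }
  set (cchi := CFun pM chi Hchi).
  set (total n := if excluded_middle_informative (M (cfst n))
                  then if excluded_middle_informative (M (csnd n)) then op (cfst n) (csnd n) else 0
                  else 0).
  (* [pop] need not halt outside [M]: it only runs in the recursion branch selected when both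
     arguments are in [M]. *)
  set (guard := EPair EVar (EAnd (EApp cchi (EFst EVar)) (EApp cchi (ESnd EVar)))).
  assert (Htotal : computes (PComp (PRec PZero (PComp pop PFst)) (compile guard)) total).
  { intro n. econstructor; [apply compile_spec|]. unfold guard. crunch. unfold cchi, chi, total. simpl.
    destruct (excluded_middle_informative (M (cfst n))) as [H1 | H1],
      (excluded_middle_informative (M (csnd n))) as [H2 | H2]; try (constructor; constructor).
    econstructor; [constructor; constructor|]. econstructor; [constructor|].
    pose proof (Hpop _ _ H1 H2) as Hn. rewrite cpair_cfst_csnd in Hn. exact Hn. }
  exists (CFun _ _ Htotal). intros a b Ha Hb. simpl. unfold total. rewrite cfst_cpair, csnd_cpair.
  destruct (excluded_middle_informative (M a)), (excluded_middle_informative (M b)); tauto.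
Qed.

Theorem proposition5 (M : nat -> Prop) (op : nat -> nat -> nat) (e : nat) :
  effective_mge_monoid M op e ->
  exists d : prog, forall T : transducer, wf_transducer M T ->
    (functional op e T -> eval d (code_transducer T) 1) /\
    (~ functional op e T -> eval d (code_transducer T) 0).
Proof.
  intros [[[unit_in [op_closed [op_assoc op_unit]]] [op_rcancel mge_exists]] [M_dec [op_computable _]]].
  destruct (total_op_computable M op M_dec op_computable) as [cmul cmul_op].
  exists (cf_prog (c_decider cmul e)). intros T T_wf.
  pose proof (cf_spec (c_decider cmul e) (code_transducer T)) as Hrun. rewrite c_decider_spec in Hrun.
  rewrite (functional_iff_no_violation M op e T (fun a b => cmul (cpair a b))); auto.
  destruct violations; split; intro H; [exact Hrun | contradiction | discriminate | exact Hrun].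
Qed.
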